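(* For any CCS processes $p$ and $q$: $p\approx q$ if and only if ($p\approx^c q$ or $p\approx^c \tau.q$ or $\tau.p\approx^c q$).
   Context: Processes. Let $\alpha$ and $\beta$ be nonempty sets. Labels are $\mathrm{name}(b)$ and $\mathrm{coname}(b)$ for $b\in\beta$; the complement $\overline{\cdot}$ exchanges $\mathrm{name}(b)$ and $\mathrm{coname}(b)$. Actions are $\tau$ and the labels. CCS processes are the terms freely generated by: $\mathrm{nil}$; variables (constants) $X\in\alpha$; $u.E$ ($u$ an action); $E+E'$; $E\,||\,E'$; $\nu L\,E$ ($L$ a set of labels); $\mathrm{relab}(E,f)$ ($f$ a function from labels to labels commuting with complement, extended to actions by $f(\tau)=\tau$); $\mathrm{rec}\,X.E$. The transition relation $E\xrightarrow{u}E'$ is the least relation such that: $u.E\xrightarrow{u}E$; if $E\xrightarrow{u}E_1$ then $E+E'\xrightarrow{u}E_1$ and $E'+E\xrightarrow{u}E_1$; if $E\xrightarrow{u}E_1$ then $E||E'\xrightarrow{u}E_1||E'$ and $E'||E\xrightarrow{u}E'||E_1$; if $E\xrightarrow{l}E_1$ and $E'\xrightarrow{\overline{l}}E_2$ for a label $l$ then $E||E'\xrightarrow{\tau}E_1||E_2$; if $E\xrightarrow{u}E_1$ and either $u=\tau$ or $u$ is a label with $u,\overline{u}\notin L$, then $\nu L\,E\xrightarrow{u}\nu L\,E_1$; if $E\xrightarrow{u}E_1$ then $\mathrm{relab}(E,f)\xrightarrow{f(u)}\mathrm{relab}(E_1,f)$; if $E\{\mathrm{rec}\,X.E/X\}\xrightarrow{u}E_1$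 then $\mathrm{rec}\,X.E\xrightarrow{u}E_1$ (the substitution replaces the occurrences of $X$ not under a binder $\mathrm{rec}\,X$). Weak notions. $E\overset{\epsilon}{\Rightarrow}E'$ is the reflexive transitive closure of $\xrightarrow{\tau}$. For any action $u$ (including $\tau$), $E\overset{u}{\Rightarrow}E'$ means there are $E_1,E_2$ with $E\overset{\epsilon}{\Rightarrow}E_1\xrightarrow{u}E_2\overset{\epsilon}{\Rightarrow}E'$. A relation $W$ on processes is a weak bisimulation if whenever $W\,E\,E'$: for each label $l$, $E\xrightarrow{l}E_1$ implies there is $E_2$ with $E'\overset{l}{\Rightarrow}E_2$ and $W\,E_1\,E_2$, and $E'\xrightarrow{l}E_2$ implies there is $E_1$ with $E\overset{l}{\Rightarrow}E_1$ and $W\,E_1\,E_2$; and $E\xrightarrow{\tau}E_1$ implies there is $E_2$ with $E'\overset{\epsilon}{\Rightarrow}E_2$ and $W\,E_1\,E_2$, and $E'\xrightarrow{\tau}E_2$ implies there is $E_1$ with $E\overset{\epsilon}{\Rightarrow}E_1$ and $W\,E_1\,E_2$. Weak equivalence: $E\approx E'$ iff $W\,E\,E'$ for some weak bisimulation $W$. Observation congruence: $E\approx^c E'$ iff for every action $u$ (including $\tau$): for every $E_1$ with $E\xrightarrow{u}E_1$ there is $E_2$ with $E'\overset{u}{\Rightarrow}E_2$ and $E_1\approx E_2$; and for every $E_2$ with $E'\xrightarrow{u}E_2$ there is $E_1$ with $E\overset{u}{\Rightarrow}E_1$ and $E_1\approx E_2$. *)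

(* Defs.v *)
From Stdlib Require Import Relations Ensembles ClassicalEpsilon.

Set Implicit Arguments.
Unset Strict Implicit.

Inductive label (beta : Type) : Type :=
| name (b : beta)
| coname (b : beta).

Definition compl (beta : Type) (l : label beta) : label beta :=
  match l with
  | name b => coname b
  | coname b => name b
  end.

Inductive action (beta : Type) : Type :=
| tau
| act (l : label beta).

Arguments tau {beta}.

Record relabeling (beta : Type) : Type := Relabeling {
  relab_label :> label beta -> label beta;
  relab_compl : forall l : label beta,
    relab_label (compl l) = compl (relab_label l)
}.

Definition relab_action (beta : Type) (f : relabeling beta) (u : action beta) :
    action beta :=
  match u with
  | tau => tau
  | act l => act (f l)
  end.

Inductive CCS (alpha beta : Type) : Type :=
| nil
| var (X : alpha)
| prefix (u : action beta) (E : CCS alpha beta)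
| sum (E E' : CCS alpha beta)
| par (E E' : CCS alpha beta)
| restr (L : Ensemble (label beta)) (E : CCS alpha beta)
| relab (E : CCS alpha beta) (f : relabeling beta)
| rec (X : alpha) (E : CCS alpha beta).

Arguments nil {alpha beta}.
Arguments var {alpha beta} X.
Arguments rec {alpha beta} X E.

(* [subst E F X] is E{F/X}.  It is not capture-avoiding: free variables of F
   may become bound.  Since alpha is an arbitrary type, equality of variables
   is decided by the informative excluded middle. *)
Fixpoint subst (alpha beta : Type) (E F : CCS alpha beta) (X : alpha) :
    CCS alpha beta :=
  match E with
  | nil => nil
  | var Y => if excluded_middle_informative (Y = X) then F else var Y
  | prefix u E1 => prefix u (subst E1 F X)
  | sum E1 E2 => sum (subst E1 F X) (subst E2 F X)
  | par E1 E2 => par (subst E1 F X) (subst E2 F X)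
  | restr L E1 => restr L (subst E1 F X)
  | relab E1 f => relab (subst E1 F X) f
  | rec Y E1 =>
      if excluded_middle_informative (Y = X) then rec Y E1
      else rec Y (subst E1 F X)
  end.

Inductive trans (alpha beta : Type) :
    CCS alpha beta -> action beta -> CCS alpha beta -> Prop :=
| trans_prefix u E : trans (prefix u E) u E
| trans_sum_l E E' u E1 : trans E u E1 -> trans (sum E E') u E1
| trans_sum_r E E' u E1 : trans E u E1 -> trans (sum E' E) u E1
| trans_par_l E E' u E1 : trans E u E1 -> trans (par E E') u (par E1 E')
| trans_par_r E E' u E1 : trans E u E1 -> trans (par E' E) u (par E' E1)
| trans_par_sync E E' l E1 E2 :
    trans E (act l) E1 -> trans E' (act (compl l)) E2 ->
    trans (par E E') tau (par E1 E2)
| trans_restr L E u E1 :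
    trans E u E1 ->
    (u = tau \/
     exists l, u = act l /\ ~ In (label beta) L l /\
               ~ In (label beta) L (compl l)) ->
    trans (restr L E) u (restr L E1)
| trans_relab E f u E1 :
    trans E u E1 -> trans (relab E f) (relab_action f u) (relab E1 f)
| trans_rec X E u E1 :
    trans (subst E (rec X E) X) u E1 -> trans (rec X E) u E1.

Definition eps_trans (alpha beta : Type) : relation (CCS alpha beta) :=
  clos_refl_trans (CCS alpha beta) (fun E E' => trans E tau E').

Definition weak_trans (alpha beta : Type) (E : CCS alpha beta)
    (u : action beta) (E' : CCS alpha beta) : Prop :=
  exists E1 E2 : CCS alpha beta,
    eps_trans E E1 /\ trans E1 u E2 /\ eps_trans E2 E'.

Definition weak_bisim (alpha beta : Type) (W : relation (CCS alpha beta)) :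
    Prop :=
  forall E E' : CCS alpha beta, W E E' ->
    (forall l : label beta,
      (forall E1, trans E (act l) E1 ->
        exists E2, weak_trans E' (act l) E2 /\ W E1 E2) /\
      (forall E2, trans E' (act l) E2 ->
        exists E1, weak_trans E (act l) E1 /\ W E1 E2)) /\
    (forall E1, trans E tau E1 ->
      exists E2, eps_trans E' E2 /\ W E1 E2) /\
    (forall E2, trans E' tau E2 ->
      exists E1, eps_trans E E1 /\ W E1 E2).

Definition weak_equiv (alpha beta : Type) (E E' : CCS alpha beta) : Prop :=
  exists W : relation (CCS alpha beta), weak_bisim W /\ W E E'.

Definition obs_congr (alpha beta : Type) (E E' : CCS alpha beta) : Prop :=
  forall u : action beta,
    (forall E1, trans E u E1 ->
      exists E2, weak_trans E' u E2 /\ weak_equiv E1 E2) /\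
    (forall E2, trans E' u E2 ->
      exists E1, weak_trans E u E1 /\ weak_equiv E1 E2).

(* Main.v *)
(* This is Hennessy's lemma.  If p and q are weakly equivalent, the only way
   they can fail to be observation congruent is that a tau-step of one of them
   is matched by the other staying put, i.e. p moves by tau to some p' with
   p' weakly equivalent to q (or the same with p and q exchanged).  That very
   step answers the initial tau of tau.q, so then p and tau.q are observation
   congruent.  For the converse, if p and tau.q are observation congruent, the
   answer p' of p to the initial tau of tau.q simulates every move of q. *)
Require Import Defs.
From Stdlib Require Import Relations Classical.

Section WeakEquivalence.

Variables alpha beta : Type.
Implicit Types (p q r : CCS alpha beta) (u : action beta).

(** The hatted weak transition of the literature. It merges the label and tau clauses of
    [weak_bisim] into one. *)
Definition weak_hat p u q : Prop :=
  match u with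
  | tau => eps_trans p q
  | act _ => weak_trans p u q
  end.

(** Only one direction of the bisimulation game, so that each argument is made once and then reused
    with the processes exchanged. *)
Definition weakly_matched p q : Prop :=
  forall u p1, trans p u p1 ->
    exists q1, weak_hat q u q1 /\ weak_equiv p1 q1.

Definition congr_matched p q : Prop :=
  forall u p1, trans p u p1 ->
    exists q1, weak_trans q u q1 /\ weak_equiv p1 q1.

Lemma eps_weak_trans p q u r :
  eps_trans p q -> weak_trans q u r -> weak_trans p u r.
Proof.
  intros Hpq (q1 & q2 & Hq & Hu & Hr).
  exists q1, q2; repeat split; trivial.
  now apply rt_trans with q.
Qed.

Lemma weak_trans_tau_eps p q : weak_trans p tau q -> eps_trans p q.
Proof.
  intros (p1 & p2 & Hp & Hu & Hq).
  apply rt_trans with p1; trivial.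
  apply rt_trans with p2; trivial.
  now apply rt_step.
Qed.

Lemma weak_trans_hat p u q : weak_trans p u q -> weak_hat p u q.
Proof.
  destruct u; simpl; trivial.
  apply weak_trans_tau_eps.
Qed.

Lemma eps_weak_hat p q u r : eps_trans p q -> weak_hat q u r -> weak_hat p u r.
Proof.
  destruct u; simpl.
  - apply rt_trans.
  - apply eps_weak_trans.
Qed.

Lemma eps_trans_inv p q :
  eps_trans p q -> p = q \/ exists r, trans p tau r /\ eps_trans r q.
Proof.
  intros H%clos_rt_rt1n.
  destruct H as [|r q Hr H]; auto.
  right; exists r; split; trivial.
  now apply clos_rt1n_rt.
Qed.

Lemma eps_trans_weak_tau p q : eps_trans p q -> p = q \/ weak_trans p tau q.
Proof.
  intros [->|(r & Hr & Hq)]%eps_trans_inv; auto.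
  right; exists p, r; repeat split; trivial.
  apply rt_refl.
Qed.

Lemma weak_trans_prefix_tau_inv p u q :
  weak_trans (prefix tau p) u q -> weak_hat p u q.
Proof.
  intros (p1 & p2 & [<-|(r & Hr & Hp1)]%eps_trans_inv & Hu & Hq).
  (* Here [u] is the guarding tau itself: what remains is a possibly empty tau-path from [p], hence
     the hat in the conclusion. *)
  - now inversion Hu; subst.
  - inversion Hr; subst.
    apply weak_trans_hat; now exists p1, p2.
Qed.

(** The guarding tau supplies the step that an empty answer to a tau lacks. *)
Lemma weak_hat_prefix_tau p u q :
  weak_hat p u q -> weak_trans (prefix tau p) u q.
Proof.
  destruct u as [|l]; simpl; intros H.
  - exists (prefix tau p), p; repeat split; trivial.
    + apply rt_refl.
    + constructor.
  - apply eps_weak_trans with p; trivial.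
    apply rt_step; constructor.
Qed.

Lemma weak_equiv_sym p q : weak_equiv p q -> weak_equiv q p.
Proof.
  intros (W & HW & Hpq).
  exists (fun r s => W s r); split; trivial.
  intros r s Hrs.
  destruct (HW _ _ Hrs) as (Hl & Ht1 & Ht2).
  repeat split; trivial; apply (Hl l).
Qed.

Lemma weak_equiv_matched p q : weak_equiv p q -> weakly_matched p q.
Proof.
  intros (W & HW & Hpq) u p1 Hu.
  destruct (HW _ _ Hpq) as (Hl & Ht & _).
  assert (H : exists q1, weak_hat q u q1 /\ W p1 q1).
  { destruct u as [|l]; [now apply Ht | now apply (Hl l)]. }
  destruct H as (q1 & Hq & HW1).
  exists q1; split; trivial.
  now exists W.
Qed.

(** Mutual matching is itself a weak bisimulation: matched moves end in weakly equivalent processes,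
    and these match each other again. *)
Lemma weakly_matched_equiv p q :
  weakly_matched p q -> weakly_matched q p -> weak_equiv p q.
Proof.
  intros Hpq Hqp.
  exists (fun r s => weakly_matched r s /\ weakly_matched s r).
  split; [|now split].
  assert (Hstep : forall r s, weakly_matched r s -> forall u r1, trans r u r1 ->
    exists s1, weak_hat s u s1 /\
      weakly_matched r1 s1 /\ weakly_matched s1 r1).
  { intros r s Hrs u r1 Hu.
    destruct (Hrs u r1 Hu) as (s1 & Hs & He).
    exists s1; split; [trivial | split]; apply weak_equiv_matched; trivial.
    now apply weak_equiv_sym. }
  intros r s [Hrs Hsr]; repeat split.
  - exact (Hstep r s Hrs (act l)).
  - intros s1 Hu; destruct (Hstep s r Hsr _ _ Hu) as (r1 & ? & ? & ?).
    now exists r1.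
  - exact (Hstep r s Hrs tau).
  - intros s1 Hu; destruct (Hstep s r Hsr _ _ Hu) as (r1 & ? & ? & ?).
    now exists r1.
Qed.

Lemma obs_congr_matched p q :
  obs_congr p q <-> congr_matched p q /\ congr_matched q p.
Proof.
  split.
  - intros H; split; intros u r Hr.
    + now apply (H u).
    + destruct (proj2 (H u) r Hr) as (r1 & Hr1 & He).
      exists r1; split; trivial.
      now apply weak_equiv_sym.
  - intros [Hpq Hqp] u; split.
    + apply Hpq.
    + intros r Hr; destruct (Hqp u r Hr) as (r1 & Hr1 & He).
      exists r1; split; trivial.
      now apply weak_equiv_sym.
Qed.

Lemma obs_congr_sym p q : obs_congr p q -> obs_congr q p.
Proof. rewrite !obs_congr_matched; tauto. Qed.

Lemma congr_matched_weakly p q : congr_matched p q -> weakly_matched p q.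
Proof.
  intros H u p1 Hu; destruct (H u p1 Hu) as (q1 & Hq & He).
  exists q1; split; trivial.
  now apply weak_trans_hat.
Qed.

Lemma obs_congr_weak_equiv p q : obs_congr p q -> weak_equiv p q.
Proof.
  intros [Hpq Hqp]%obs_congr_matched.
  apply weakly_matched_equiv; now apply congr_matched_weakly.
Qed.

Lemma obs_congr_prefix_tau_weak_equiv p q :
  obs_congr p (prefix tau q) -> weak_equiv p q.
Proof.
  intros [Hpq Hqp]%obs_congr_matched.
  apply weakly_matched_equiv; intros u r Hr.
  - destruct (Hpq u r Hr) as (q1 & Hq & He).
    exists q1; split; trivial.
    now apply weak_trans_prefix_tau_inv.
  (* A move of [q] is answered by going first to [p'], which is weakly equivalent to [q], and
     replying from there. *)
  - destruct (Hqp tau q (trans_prefix _ _)) as (p' & Hp' & He').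
    destruct (weak_equiv_matched _ _ He' u r Hr) as (p1 & Hp1 & He).
    exists p1; split; trivial.
    apply eps_weak_hat with p'; trivial.
    now apply weak_trans_tau_eps.
Qed.

Lemma weak_equiv_obs_congr_prefix_tau p q p' :
  weak_equiv p q -> trans p tau p' -> weak_equiv p' q ->
  obs_congr p (prefix tau q).
Proof.
  intros Hpq Hp' He'.
  apply obs_congr_matched; split; intros u r Hr.
  - destruct (weak_equiv_matched _ _ Hpq u r Hr) as (q1 & Hq & He).
    exists q1; split; trivial.
    now apply weak_hat_prefix_tau.
  - inversion Hr; subst.
    exists p'; split; [|now apply weak_equiv_sym].
    exists p, p'; repeat split; trivial; apply rt_refl.
Qed.

Lemma weak_equiv_congr_matched p q :
  weak_equiv p q -> ~ (exists p', trans p tau p' /\ weak_equiv p' q) ->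
  congr_matched p q.
Proof.
  intros Hpq Hstay u p1 Hu.
  destruct (weak_equiv_matched _ _ Hpq u p1 Hu) as (q1 & Hq & He).
  exists q1; split; trivial.
  destruct u as [|l]; trivial.
  (* An empty answer would make [p1] weakly equivalent to [q] itself, which [Hstay] forbids. *)
  destruct (eps_trans_weak_tau _ _ Hq) as [<-|]; trivial.
  destruct Hstay; now exists p1.
Qed.

End WeakEquivalence.

Theorem theorem9 (alpha beta : Type) (Halpha : inhabited alpha)
    (Hbeta : inhabited beta) (p q : CCS alpha beta) :
  weak_equiv p q <->
  (obs_congr p q \/ obs_congr p (prefix tau q) \/ obs_congr (prefix tau p) q).
Proof.
  split.
  - intros Hpq.
    pose proof (weak_equiv_sym _ _ _ _ Hpq) as Hqp.
    destruct (classic (exists p', trans p tau p' /\ weak_equiv p' q))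
      as [(p' & Hp' & He)|Hp].
    { right; left; now apply weak_equiv_obs_congr_prefix_tau with p'. }
    destruct (classic (exists q', trans q tau q' /\ weak_equiv q' p))
      as [(q' & Hq' & He)|Hq].
    { right; right; apply obs_congr_sym.
      now apply weak_equiv_obs_congr_prefix_tau with q'. }
    (* Neither process has a tau-step that the other could answer by staying put. *)
    left; apply obs_congr_matched; split; now apply weak_equiv_congr_matched.
  - intros [H|[H|H]].
    + now apply obs_congr_weak_equiv.
    + now apply obs_congr_prefix_tau_weak_equiv.
    + apply weak_equiv_sym, obs_congr_prefix_tau_weak_equiv.
      now apply obs_congr_sym.
Qed.
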